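(* For every bipartite graph $\mathcal G$ and every subgroup $Gr\subset Aut(\mathcal G)$, the space $Hom(\mathcal G,C_4)$ of graph homomorphisms from $\mathcal G$ to the $4$-cycle $C_4$ is both Hammersley-Clifford and $Gr$-Hammersley-Clifford.
   Context: A graph $\mathcal G=(\mathcal V,\mathcal E)$ is a countable, locally finite, undirected graph without self-loops or multiple edges; $\sim$ denotes adjacency. $\partial F=\{u\in\mathcal V\setminus F: u\sim v\text{ for some }v\in F\}$. A clique is a finite set of pairwise adjacent vertices (single vertices included). $Aut(\mathcal G)$ is the group of adjacency-preserving bijections of $\mathcal V$ (in both directions). $C_4$ is the cycle on $4$ vertices; $Hom(\mathcal G,\mathcal H)$ is the set of maps $x:\mathcal V\to\mathcal V_{\mathcal H}$ with $x_v\sim_{\mathcal H}x_w$ whenever $v\sim w$, regarded as a closed subset of $\mathcal A^{\mathcal V}$ with $\mathcal A=\mathcal V_{\mathcal H}$. For closed $X\subset\mathcal A^{\mathcal V}$ ($\mathcal A$ finite), $\mathcal L(X)=\{x|_F:x\in X,\ F\subset\mathcal V\text{ finite}\}$. For $g\in Aut(\mathcal G)$, $(gx)_v=x_{g^{-1}v}$, and for $\alpha\in\mathcal A^F$, $g\alpha\in\mathcal A^{gF}$ is $(g\alpha)_{gv}=\alpha_v$; $X$ is $Gr$-invariant if $gX=X$ for all $g\in Gr$. $\Delta_X=\{(x,y)\in X\times X: x,y\text{ differ at finitely many sites}\}$. A $\Delta_X$-cocycle is $M:\Delta_X\to\mathbb R$ with $M(x,z)=M(x,y)+M(y,z)$ for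 $(x,y),(y,z)\in\Delta_X$. It is a Markov cocycle if $M(x,y)$ depends only on $x|_{F\cup\partial F}$ and $y|_{F\cup\partial F}$, where $F$ is the set of sites where $x$ and $y$ differ; it is $Gr$-invariant if $M(gx,gy)=M(x,y)$ for all $g\in Gr$. A nearest neighbour interaction on $X$ is $V:\mathcal L(X)\to\mathbb R$ vanishing on patterns on finite sets that are not cliques; it is $Gr$-invariant if $V(g^{-1}\alpha)=V(\alpha)$ for all $g\in Gr$ and all $\alpha$. The Gibbs cocycle with interaction $V$ is $M(x,y)=\sum_{A\subset\mathcal V\text{ finite}}\big(V(y|_A)-V(x|_A)\big)$. $X$ is Hammersley-Clifford if every Markov cocycle on $X$ is a Gibbs cocycle with some nearest neighbour interaction (and conversely, i.e. the two spaces are equal); a $Gr$-invariant $X$ is $Gr$-Hammersley-Clifford if the space of $Gr$-invariant Markov cocycles on $X$ equals the space of Gibbs cocycles on $X$ with $Gr$-invariant nearest neighbour interactions. *)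

(* Defs.v *)
From HB Require Import structures.
From mathcomp Require Import all_boot all_order all_algebra finmap.
From mathcomp Require Import all_classical all_reals.

Set Implicit Arguments.
Unset Strict Implicit.
Unset Printing Implicit Defensive.

Local Open Scope classical_set_scope.
Local Open Scope ring_scope.

Record graph (T : countType) := Graph {
  adj :> rel T;
  adj_sym : symmetric adj;
  adj_irr : irreflexive adj;
  adj_locfin : forall v, finite_set [set w | adj v w]
}.

(* The two sides are the fibres of c; either may be empty. *)
Definition bipartite (T : countType) (G : graph T) : Prop :=
  exists c : T -> bool, forall u v, G u v -> c u != c v.

Definition clique (T : countType) (G : graph T) (F : {fset T}) : Prop :=
  {in F &, forall u v, u != v -> G u v}.

Definition boundary (T : countType) (G : graph T) (F : set T) : set T :=
  [set u | ~ F u /\ exists2 v, F v & G u v].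

Record aut (T : countType) (G : graph T) := Aut {
  aut_fun :> T -> T;
  aut_inv : T -> T;
  aut_funK : cancel aut_fun aut_inv;
  aut_invK : cancel aut_inv aut_fun;
  aut_adj : forall u v, G (aut_fun u) (aut_fun v) = G u v
}.

Section AutGroup.
Variables (T : countType) (G : graph T).

(* The stored inverse is determined by the map. *)
Lemma aut_ext (g h : aut G) : aut_fun g =1 aut_fun h -> g = h.
Proof.
case: g h => [f f' fK f'K fa] [k k' kK k'K ka] /= /funext fk; subst k.
have f'k' : f' = k' by apply/funext => v; rewrite -{1}(k'K v) fK.
subst k'.
by congr Aut; exact: Prop_irrelevance.
Qed.

Definition aut_one : aut G := Aut (fun=> erefl) (fun=> erefl) (fun _ _ => erefl).

Lemma aut_mul_adj (g h : aut G) u v : G ((g \o h) u) ((g \o h) v) = G u v.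
Proof. by rewrite /= !aut_adj. Qed.

Definition aut_mul (g h : aut G) : aut G :=
  Aut (can_comp (aut_funK g) (aut_funK h))
      (can_comp (aut_invK h) (aut_invK g)) (aut_mul_adj g h).

Lemma aut_inv_adj (g : aut G) u v : G (aut_inv g u) (aut_inv g v) = G u v.
Proof. by rewrite -(aut_adj g) !aut_invK. Qed.

Definition aut_V (g : aut G) : aut G :=
  Aut (aut_invK g) (aut_funK g) (aut_inv_adj g).

Lemma aut_mulA : associative aut_mul.
Proof. by move=> g h k; exact: aut_ext. Qed.
Lemma aut_mul1 : left_id aut_one aut_mul.
Proof. by move=> g; exact: aut_ext. Qed.
Lemma aut_mulr1 : right_id aut_one aut_mul.
Proof. by move=> g; exact: aut_ext. Qed.
Lemma aut_mulV : left_inverse aut_one aut_V aut_mul.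
Proof. by move=> g; apply: aut_ext => v; exact: aut_funK. Qed.
Lemma aut_mulrV : right_inverse aut_one aut_V aut_mul.
Proof. by move=> g; apply: aut_ext => v; exact: aut_invK. Qed.

HB.instance Definition _ := gen_eqMixin (aut G).
HB.instance Definition _ := gen_choiceMixin (aut G).
HB.instance Definition _ := isGroup.Build (aut G)
  aut_mulA aut_mul1 aut_mulr1 aut_mulV aut_mulrV.
End AutGroup.

Definition Hom_space (T : countType) (G : graph T) (A : finType) (H : graph A) :
    set (T -> A) :=
  [set x | forall v w, G v w -> H (x v) (x w)].

Definition C4_adj : rel 'I_4 :=
  fun i j => (j == i.+1 %% 4 :> nat)%N || (i == j.+1 %% 4 :> nat)%N.

Lemma C4_sym : symmetric C4_adj.
Proof. by move=> i j; rewrite /C4_adj orbC. Qed.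

Lemma C4_irr : irreflexive C4_adj.
Proof. by case=> [[|[|[|[|]]]]]. Qed.

Lemma C4_locfin (v : 'I_4) : finite_set [set w | C4_adj v w].
Proof. exact: finite_finset. Qed.

Definition C4 : graph 'I_4 := Graph C4_sym C4_irr C4_locfin.

Section Cocycles.
Variables (R : realType) (T : countType) (A : finType) (G : graph T).
Implicit Types (X : set (T -> A)) (x y : T -> A).

(* An element of A^F, for F a finite set of vertices, is a finite map with
   domain F. *)
Notation pattern := {fmap T -> A}.

Definition restr x (F : {fset T}) : pattern := [fmap v : F => x (val v)].

Definition language X : set pattern :=
  [set a | exists x F, X x /\ a = restr x F].

Definition act (g : aut G) x : T -> A := fun v => x ((g^-1)%g v).

Lemma act_pattern_subproof (g : aut G) (F : {fset T})
  (w : [fset g v | v in F]%fset) : (g^-1)%g (val w) \in F.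
Proof. by case: w => w /= /imfsetP[v /= vF ->]; rewrite aut_funK. Qed.

Definition act_pattern (g : aut G) (a : pattern) : pattern :=
  [fmap w : [fset g v | v in domf a]%fset =>
    a.[act_pattern_subproof w]]%fmap.

Definition invariant_space (Gr : {pred aut G}) X : Prop :=
  forall g, g \in Gr -> act g @` X = X.

Definition differ x y : set T := [set v | x v <> y v].

Definition Delta X x y : Prop := [/\ X x, X y & finite_set (differ x y)].

(* Cocycles and interactions are total functions of which only the values on
   Delta X, respectively on language X, are ever constrained or used. *)

Definition cocycle X (M : (T -> A) -> (T -> A) -> R) : Prop :=
  forall x y z, Delta X x y -> Delta X y z -> M x z = M x y + M y z.

(* The restrictions of x and y to F `|` boundary G F determine M x y; equality
   of the two difference sets says that (x, y) and (x', y') have the same F. *)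
Definition markov X (M : (T -> A) -> (T -> A) -> R) : Prop :=
  forall x y x' y', Delta X x y -> Delta X x' y' ->
    differ x' y' = differ x y ->
    {in differ x y `|` boundary G (differ x y), x =1 x'} ->
    {in differ x y `|` boundary G (differ x y), y =1 y'} ->
    M x y = M x' y'.

Definition invariant_cocycle (Gr : {pred aut G}) X
    (M : (T -> A) -> (T -> A) -> R) : Prop :=
  forall g, g \in Gr ->
    forall x y, Delta X x y -> M (act g x) (act g y) = M x y.

Definition nn_interaction X (V : pattern -> R) : Prop :=
  forall a, language X a -> ~ clique G (domf a) -> V a = 0.

Definition invariant_interaction (Gr : {pred aut G}) X (V : pattern -> R) :
    Prop :=
  forall g, g \in Gr ->
    forall a, language X a -> V (act_pattern (g^-1)%g a) = V a.

(* For a nearest neighbour interaction V and (x, y) in Delta X only finitely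
   many terms are nonzero, by local finiteness. *)
Definition gibbs_sum (V : pattern -> R) x y : R :=
  \sum_(F \in [set: {fset T}]) (V (restr y F) - V (restr x F)).

Definition markov_cocycles X : set ((T -> A) -> (T -> A) -> R) :=
  [set M | cocycle X M /\ markov X M].

Definition gibbs_cocycles X : set ((T -> A) -> (T -> A) -> R) :=
  [set M | exists2 V, nn_interaction X V &
    forall x y, Delta X x y -> M x y = gibbs_sum V x y].

Definition inv_markov_cocycles (Gr : {pred aut G}) X :
    set ((T -> A) -> (T -> A) -> R) :=
  markov_cocycles X `&` [set M | invariant_cocycle Gr X M].

Definition inv_gibbs_cocycles (Gr : {pred aut G}) X :
    set ((T -> A) -> (T -> A) -> R) :=
  [set M | exists2 V, nn_interaction X V /\ invariant_interaction Gr X V &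
    forall x y, Delta X x y -> M x y = gibbs_sum V x y].

Definition hammersley_clifford X : Prop :=
  markov_cocycles X = gibbs_cocycles X.

Definition Gr_hammersley_clifford (Gr : {pred aut G}) X : Prop :=
  invariant_space Gr X /\ inv_markov_cocycles Gr X = inv_gibbs_cocycles Gr X.
End Cocycles.

(* Main.v *)
Require Import Defs.
From mathcomp Require Import all_boot all_algebra finmap.
From mathcomp Require Import all_classical all_reals.

(** Adjacency in the 4-cycle means opposite parity, so a homomorphism to it is a
    proper two-colouring of the graph (the parity field) together with a free
    choice, at each vertex, between the two symbols of the prescribed parity.
    Reducing symbols modulo 2 sends every configuration x to the reference
    configuration [level (parity x)] with the same parity field; more
    generally [paste x B] keeps x on the finite set B and is reduced outside
    it.  The reference symbol of the right parity is allowed at every vertex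
    whatever the symbols around it, so it acts as a safe symbol and the
    classical Moebius argument applies: if M is a Markov cocycle, the Moebius
    transform of

    energy x B = M (level (parity x)) (paste x B) + swap energies over B

    in the set B depends only on x restricted to B (the parity field is
    determined on the neighbours of B), vanishes when B has two non-adjacent
    elements ([mobius_interaction_nn]: changing the symbol at one of them does
    not affect the cost of changing it at the other), and sums over the subsets
    of a finite set E to [energy x E].

    Two asymptotic configurations can have different parity fields, but only by
    a swap of the two colours on finitely many finite components.  A component C
    has no boundary, so M gives such a swap a cost depending only on the
    parity field on C, and the costs of different components add up.  The swap
    energy spreads half of this cost, with the sign given by the parity, evenly
    over the vertices of C; this uses no choice of a vertex or of a colour
    class, hence is equivariant.  By [sum_swap_energy] these single-site terms
    add up to the cost of passing from one reference configuration to another,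
    and [mobius_interaction_gibbs] follows by going from x to y through the two
    references.  The construction commutes with every automorphism that
    preserves M ([mobius_interaction_inv]), which settles the invariant
    version together with the plain one.

    Conversely ([gibbs_cocycle_markov], [gibbs_sum_inv]), for a nearest
    neighbour interaction the Gibbs sum is a sum over subsets of any finite set
    containing D and its boundary, where D is the set of differences, so it is a
    Markov cocycle, and it inherits the invariance of the interaction. *)

Set Implicit Arguments.
Unset Strict Implicit.
Unset Printing Implicit Defensive.

Import GRing.Theory Num.Theory.

Local Open Scope classical_set_scope.
Local Open Scope ring_scope.

(** * Moebius inversion over finite sets *)

Section Mobius.
Variables (K : choiceType) (R : pzRingType).
Implicit Types (h : {fset K} -> R) (F E : {fset K}).

Lemma big_fpowersetU1 h u F : u \notin F ->
  \sum_(B <- fpowerset (u |` F)%fset) h B =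
  \sum_(B <- fpowerset F) (h B + h (u |` B)%fset).
Proof.
move=> uF; rewrite (big_fsetID _ (fun B : {fset K} => u \notin B)) big_split /=.
have sub (B : {fset K}) : B \in fpowerset F -> u \notin B.
  by rewrite fpowersetE => /fsubsetP BF; apply: contra uF => /BF.
congr (_ + _).
  apply: eq_fbigl => B; rewrite !inE /= !fpowersetE.
  apply/andP/idP => [[/fsubsetP BuF uB]|BF]; last first.
    split; first exact: fsubset_trans BF (fsubsetUr _ _).
    by apply: sub; rewrite fpowersetE.
  apply/fsubsetP => v vB; move: (BuF v vB); rewrite !inE => /predU1P[vu|//].
  by rewrite -vu vB in uB.
transitivity (\sum_(C <- [fset (u |` B)%fset | B in fpowerset F]%fset) h C);
  last first.
  rewrite big_imfset //= => B C /sub uB /sub uC eq.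
  by rewrite -(fsetU1K uB) eq fsetU1K.
apply: eq_fbigl => B; rewrite !inE /= fpowersetE negbK.
apply/andP/imfsetP => [[/fsubsetP BuF uB]|[C /= CF ->]]; last first.
  by rewrite fsetU11 fsetUS // -fpowersetE.
exists (B `\ u)%fset; last by rewrite fsetD1K.
rewrite /= fpowersetE; apply/fsubsetP => v; rewrite !inE => /andP[vu vB].
by move: (BuF v vB); rewrite !inE (negPf vu).
Qed.

(** The sign is that of the cardinality of F minus B; adding the cardinalities
    avoids the truncated difference. *)
Definition mobius h F : R :=
  \sum_(B <- fpowerset F) (-1) ^+ (#|` F| + #|` B|) * h B.

(** Adding a point to F amounts to taking the first difference of h in the
    direction of that point. *)
Lemma mobiusU1 h u F : u \notin F ->
  mobius h (u |` F)%fset = mobius (fun B => h (u |` B)%fset - h B) F.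
Proof.
move=> uF; rewrite /mobius big_fpowersetU1 //.
apply: eq_fbigr => B; rewrite fpowersetE => /fsubsetP BF _.
have uB : u \notin B by apply: contra uF => /BF.
rewrite !cardfsU1 uF uB addSn addnS !exprS !mulN1r opprK mulrBr mulNr.
by rewrite addrC.
Qed.

Lemma eq_mobius h h' F : (forall B, (B `<=` F)%fset -> h B = h' B) ->
  mobius h F = mobius h' F.
Proof.
by move=> hh'; apply: eq_fbigr => B; rewrite fpowersetE => /hh' -> _.
Qed.

(** The defining property of the Moebius transform; it follows by induction on E
    because the transform at F plus the one at F with u added is the transform
    at F of h shifted by u. *)
Lemma mobius_sum h E : \sum_(F <- fpowerset E) mobius h F = h E.
Proof.
elim/fset1U_rect: E h => [|u E uE IH] h.
  rewrite fpowerset0 big_seq_fset1 /mobius fpowerset0 big_seq_fset1.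
  by rewrite cardfs0 mul1r.
rewrite big_fpowersetU1 // -(IH (fun B => h (u |` B)%fset)).
apply: eq_fbigr => F; rewrite fpowersetE => /fsubsetP FE _.
have uF : u \notin F by apply: contra uE => /FE.
rewrite mobiusU1 // /mobius -big_split /=.
by apply: eq_bigr => B _; rewrite mulrBr addrC subrK.
Qed.

Lemma mobius_imfset (L : choiceType) (g : L -> K) (F : {fset L}) h :
  injective g ->
  mobius h (g @` F)%fset = \sum_(B <- fpowerset F)
    (-1) ^+ (#|` F| + #|` B|) * h (g @` B)%fset.
Proof.
move=> gI; rewrite /mobius.
have -> : fpowerset (g @` F)%fset =
    ((fun B : {fset L} => g @` B)%fset @` fpowerset F)%fset.
  apply/fsetP => B; rewrite fpowersetE; apply/idP/imfsetP => [BF|[C /= CF ->]].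
    exists [fset v in F | g v \in B]%fset => /=.
      by rewrite fpowersetE; apply/fsubsetP => v; rewrite !inE => /andP[].
    apply/fsetP => w; apply/idP/imfsetP => [wB|[v /=]].
      have /imfsetP[v /= vF wv] := fsubsetP BF w wB.
      by exists v; rewrite // !inE vF -wv.
    by rewrite !inE => /andP[_ vB] ->.
  rewrite fpowersetE in CF; apply/fsubsetP => _ /imfsetP[v /= vC ->].
  by rewrite in_imfset //= (fsubsetP CF).
rewrite big_imfset /=; last first.
  move=> B C _ _ /fsetP BC; apply/fsetP => v; have := BC (g v).
  by rewrite !mem_imfset.
by apply: eq_bigr => B _; rewrite !card_imfset.
Qed.

(** Applying [mobiusU1] at u and at w leaves the transform of a second
    difference of h. *)
Lemma mobius0 h F u w : u != w -> u \in F -> w \in F ->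
  (forall B, (B `<=` F)%fset -> u \notin B -> w \notin B ->
    h (u |` (w |` B))%fset - h (u |` B)%fset = h (w |` B)%fset - h B) ->
  mobius h F = 0.
Proof.
move=> uw uF wF hF.
have wFu : w \in (F `\ u)%fset by rewrite !inE eq_sym uw.
rewrite -(fsetD1K uF) mobiusU1 ?fsetD11 // -(fsetD1K wFu) mobiusU1 ?fsetD11 //.
rewrite /mobius big1_fset // => B; rewrite fpowersetE => /fsubsetP BF _.
rewrite [X in _ * X](_ : _ = 0) ?mulr0 //.
have uB : u \notin B by apply/negP => /BF; rewrite !inE eqxx !andbF.
have wB : w \notin B by apply/negP => /BF; rewrite !inE eqxx.
have /hF/(_ uB wB) eqh : (B `<=` F)%fset.
  by apply/fsubsetP => v /BF; rewrite !inE => /and3P[].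
move/eqP: eqh; rewrite subr_eq => /eqP ->.
rewrite [_ - h (w |` B)%fset]addrAC [_ - _ - _]addrAC subrr sub0r.
by rewrite [- _ + _]addrC subrr.
Qed.

End Mobius.

(** * Gibbs cocycles *)

Section Automorphisms.
Variables (T : countType) (G : graph T) (g : aut G).

Lemma aut_mulKV v : (g^-1)%g (g v) = v.
Proof. exact: aut_funK. Qed.

Lemma aut_mulVK v : g ((g^-1)%g v) = v.
Proof. exact: aut_invK. Qed.

End Automorphisms.

Section Gibbs.
Variables (R : realType) (T : countType) (A : finType) (G : graph T).
Variable X : set (T -> A).
Implicit Types (V : {fmap T -> A} -> R) (x y : T -> A) (F E : {fset T}).

Lemma restrP x y F : restr x F = restr y F <-> {in F, x =1 y}.
Proof.
split=> [/fmapP xy v vF|xy].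
  have vF' z : v \in domf (restr z F) by [].
  have := xy v; rewrite !in_fnd /restr => -[].
  by rewrite !ffunE.
apply/fmapP => v; have [vF|vF] := boolP (v \in F); last by rewrite !not_fnd.
by rewrite !in_fnd !ffunE /= xy.
Qed.

Lemma finite_boundary (D : set T) : finite_set D -> finite_set (boundary G D).
Proof.
move=> Dfin; apply: (@sub_finite_set _ _ (\bigcup_(v in D) [set w | G v w])).
  by move=> u [_ [v Dv Guv]]; exists v => //=; rewrite adj_sym.
by apply: bigcup_finite => // v _; exact: adj_locfin.
Qed.

(** A clique that meets the set of differences lies in it together with its
    boundary; any other finite set contributes zero. *)
Lemma gibbs_sumE V x y E : nn_interaction G X V -> X x -> X y ->
  differ x y `|` boundary G (differ x y) `<=` [set` E] ->
  gibbs_sum V x y =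
  \sum_(F <- fpowerset E) (V (restr y F) - V (restr x F)).
Proof.
move=> nnV Xx Xy DE; apply: fsbigTE => F; rewrite fpowersetE => FE.
have [Fcl|Fcl] := pselect (clique G F); last first.
  by rewrite !nnV ?subrr //; [exists x, F|exists y, F].
have /fsubsetPn[w wF wE] := FE.
suff -> : restr y F = restr x F by rewrite subrr.
apply/restrP => v vF; apply: contrapT => yx.
have Dv : differ x y v by move=> xy; apply: yx.
have nDw : ~ differ x y w by move=> Dw; move/negP: wE; apply; apply: DE; left.
move/negP: wE; apply; apply: DE; right; split=> //; exists v => //.
by apply: Fcl => //; apply/eqP => wv; apply: nDw; rewrite wv.
Qed.

(** Locality of the Gibbs sum is [gibbs_sumE]; for additivity, all three sums
    are written over the subsets of one common finite set. *)
Lemma gibbs_cocycle_markov : gibbs_cocycles G X `<=` @markov_cocycles R T A G X.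
Proof.
have finE x y : finite_set (differ x y) ->
    exists E : {fset T}, differ x y `|` boundary G (differ x y) = [set` E].
  move=> fD; apply/finite_fsetP; rewrite finite_setU.
  by split=> //; exact: finite_boundary.
move=> M [V nnV MV]; split=> [x y z xy yz|x y x' y' xy xy' DD xx' yy'].
- have [[Xx Xy fxy] [_ Xz fyz]] := (xy, yz).
  have xz : differ x z `<=` differ x y `|` differ y z.
    move=> v xz; apply: contrapT => /not_orP[/contrapT + /contrapT].
    by congruence.
  have fxz : finite_set (differ x z).
    by apply: (sub_finite_set xz); rewrite finite_setU.
  have [E1 E1E] := finE _ _ fxy; have [E2 E2E] := finE _ _ fyz.
  have [E3 E3E] := finE _ _ fxz.
  rewrite !MV //.
  rewrite !(@gibbs_sumE _ _ _ (E1 `|` (E2 `|` E3))%fset) //.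
  + rewrite -big_split /=; apply: eq_bigr => F _.
    by rewrite addrC addrA subrK.
  + by rewrite E2E => v /= vE; rewrite !inE vE orbT.
  + by rewrite E1E => v /= vE; rewrite !inE vE.
  + by rewrite E3E => v /= vE; rewrite !inE vE !orbT.
have [[Xx Xy fxy] [Xx' Xy' _]] := (xy, xy').
have [E EE] := finE _ _ fxy.
rewrite !MV // !(@gibbs_sumE _ _ _ E) ?DD ?EE //.
apply: eq_fbigr => F; rewrite fpowersetE => /fsubsetP FE _.
have sub v : v \in F -> v \in differ x y `|` boundary G (differ x y).
  by move=> /FE vE; rewrite EE; exact: mem_set.
by congr (V _ - V _); apply/restrP => v /sub; [exact: yy'|exact: xx'].
Qed.

Lemma restr_act (g : aut G) x F :
  act_pattern g (restr x F) = restr (act g x) (g @` F)%fset.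
Proof.
apply/fmapP => v; have [vF|vF] := boolP (v \in (g @` F)%fset).
  by rewrite !in_fnd; congr Some; rewrite !ffunE.
by rewrite !not_fnd.
Qed.

Lemma gibbs_sum_inv (Gr : {pred aut G}) V (g : aut G) x y :
  group_closed Gr -> invariant_interaction Gr X V -> g \in Gr -> X x -> X y ->
  gibbs_sum V (act g x) (act g y) = gibbs_sum V x y.
Proof.
move=> GrG Vinv gGr Xx Xy; rewrite /gibbs_sum.
have gbij : bijective (fun F : {fset T} => (g @` F)%fset).
  exists (fun F : {fset T} => ((g^-1)%g : aut G) @` F)%fset => F;
    rewrite -imfset_comp -[RHS]imfset_id; apply: eq_imfset => // v /=.
    exact: aut_mulKV.
  exact: aut_mulVK.
rewrite (reindex_fsbigT _ _ gbij); apply: eq_fsbigr => F _.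
have gV : (g^-1)%g \in Gr by apply: group_closedV.
rewrite -!restr_act -[g]invgK !Vinv //; first by exists x, F.
by exists y, F.
Qed.

End Gibbs.

(** * Connected components and two-colourings *)

Section Components.
Variables (T : countType) (G : graph T).
Implicit Types (S : set T) (p q : T -> bool).

Definition adj_closed S := forall u w, G u w -> S u -> S w.

(** The connected component, as the least set containing v and closed under
    adjacency. *)
Definition component v : set T :=
  [set w | forall S, adj_closed S -> S v -> S w].

Definition alternating p := forall u w, G u w -> p u != p w.

Definition flip S p : T -> bool := fun v => p v (+) (v \in S).

Lemma component_refl v : component v v.
Proof. by []. Qed.

Lemma component_closed v : adj_closed (component v).
Proof. by move=> u w uw vu S Scl Sv; exact: Scl uw (vu S Scl Sv). Qed.

Lemma component_sub S v : adj_closed S -> S v -> component v `<=` S.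
Proof. by move=> Scl Sv w; exact. Qed.

Lemma adj_closedC S : adj_closed S -> adj_closed (~` S).
Proof.
by move=> Scl u w uw nSu Sw; apply/nSu/(Scl w u) => //; rewrite adj_sym.
Qed.

(** If v were not in the component of w, the complement of the latter would be a
    closed set that contains v but not w. *)
Lemma component_eq v w : component v w -> component w = component v.
Proof.
move=> vw; apply/seteqP; split; last first.
  have [wv|nwv] := pselect (component w v).
    exact: component_sub (component_closed (v := w)) wv.
  by case: (vw _ (adj_closedC (component_closed (v := w))) nwv).
exact: component_sub (component_closed (v := v)) vw.
Qed.

Lemma boundary_closed S : adj_closed S -> boundary G S = set0.
Proof.
move=> Scl; apply/seteqP; split=> // u [nSu [v Sv uv]].
by apply: nSu; apply: Scl Sv; rewrite adj_sym.
Qed.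

Lemma alternating_flip S p : adj_closed S -> alternating p ->
  alternating (flip S p).
Proof.
move=> Scl palt u w uw; have := palt u w uw; rewrite /flip.
suff -> : (u \in S) = (w \in S) by case: (p u); case: (p w); case: (w \in S).
apply/idP/idP; rewrite !inE => ?; first exact: Scl uw _.
by apply: (Scl w u) => //; rewrite adj_sym.
Qed.

Lemma flipE S p v : (flip S p v != p v) = (v \in S).
Proof. by rewrite /flip; case: (p v); case: (v \in S). Qed.

(** A two-colouring of a component is determined by the colour of one vertex. *)
Lemma alternating_agree p q v : alternating p -> alternating q -> p v = q v ->
  {in component v, p =1 q}.
Proof.
move=> palt qalt pq w; rewrite inE => vw.
apply: (component_sub (S := [set u | p u = q u]) _ pq vw).
move=> a b ab /= pqa; have := palt a b ab; have := qalt a b ab; rewrite pqa.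
by case: (p b); case: (q b); case: (q a).
Qed.

(** Two colourings that differ at a vertex differ at each of its neighbours. *)
Lemma differ_closed p q : alternating p -> alternating q ->
  adj_closed [set v | p v != q v].
Proof.
move=> palt qalt u w uw /=; have := palt u w uw; have := qalt u w uw.
by case: (p u); case: (p w); case: (q u); case: (q w).
Qed.

Lemma component_aut (g : aut G) v : component (g v) = g @` component v.
Proof.
have sub (h : aut G) u : component (h u) `<=` h @` component u.
  apply: component_sub; last by exists u.
  move=> b' b + [a ua b'E]; rewrite -b'E => hab.
  exists (aut_inv h b); last exact: aut_invK.
  by apply: component_closed ua; rewrite -(aut_adj h) aut_invK.
apply/seteqP; split=> [|_ [w vw <-]]; first exact: sub.
have : component ((g^-1)%g (g v)) w by rewrite [(g^-1)%g _]aut_funK.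
by move=> /(sub (g^-1)%g (g v))[u gvu <-]; rewrite aut_mulVK.
Qed.

End Components.

(** * Homomorphisms to the 4-cycle *)

Section HomC4.
Variables (R : realType) (T : countType) (G : graph T).
Notation config := (T -> 'I_4).
Notation X := (Hom_space G C4).
Implicit Types (x y : config) (p q : T -> bool) (S : set T) (B F : {fset T}).

Definition parity x : T -> bool := fun v => odd (x v).

(** The colour false becomes the symbol 0 and the colour true the symbol 1. *)
Definition level p : config := fun v => inord (p v).

Definition paste x B : config :=
  fun v => if v \in B then x v else level (parity x) v.

Lemma C4_adjE (i j : 'I_4) : C4 i j = (odd i != odd j).
Proof. by case: i j => [[|[|[|[|]]]] //= ?] [[|[|[|[|]]]]]. Qed.

Lemma HomP x : X x <-> alternating G (parity x).
Proof. by split=> Xx u w /Xx; rewrite C4_adjE. Qed.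

Lemma odd_level p v : odd (level p v) = p v.
Proof. by rewrite /level inordK; case: (p v). Qed.

Lemma parity_level p : parity (level p) = p.
Proof. by apply/funext => v; exact: odd_level. Qed.

Lemma parity_paste x B : parity (paste x B) = parity x.
Proof.
by apply/funext => v; rewrite /parity /paste; case: ifP; rewrite ?odd_level.
Qed.

Lemma Hom_level p : alternating G p -> X (level p).
Proof. by move=> palt; apply/HomP; rewrite parity_level. Qed.

Lemma Hom_paste x B : X x -> X (paste x B).
Proof. by move=> /HomP Xx; apply/HomP; rewrite parity_paste. Qed.

Lemma differ_level p q : differ (level p) (level q) = [set v | p v != q v].
Proof.
apply/seteqP; split=> v /= pq; last first.
  by move=> lpq; move/eqP: pq; apply; rewrite -odd_level lpq odd_level.
by apply/eqP => eqpq; apply: pq; rewrite /level eqpq.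
Qed.

Lemma differ_flip S p : differ (level p) (level (flip S p)) = S.
Proof.
by rewrite differ_level; apply/seteqP; split=> v /=; rewrite eq_sym flipE inE.
Qed.

Lemma differC x y : differ x y = differ y x.
Proof. by apply/seteqP; split=> v /= xy yx; apply: xy. Qed.

Lemma Delta_paste x B C : X x -> Delta X (paste x B) (paste x C).
Proof.
move=> Xx; split; [exact: Hom_paste|exact: Hom_paste|].
apply: (@sub_finite_set _ _ [set` (B `|` C)%fset]) => // v /= BC.
rewrite inE; apply/negPn/negP; rewrite negb_or => /andP[vB vC].
by apply: BC; rewrite /paste (negPf vB) (negPf vC).
Qed.

Lemma level_paste x : level (parity x) = paste x fset0.
Proof. by apply/funext => v; rewrite /paste inE. Qed.

Section MarkovCocycle.
Variable M : config -> config -> R.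
Hypothesis MM : markov_cocycles G X M.

(** Equality of the two sets of differences makes the second pair asymptotic as
    soon as the first one is. *)
Lemma markov_eq x y x' y' : Delta X x y -> X x' -> X y' ->
  differ x' y' = differ x y ->
  (forall v, (differ x y `|` boundary G (differ x y)) v ->
    x v = x' v /\ y v = y' v) -> M x y = M x' y'.
Proof.
move=> xy Xx' Xy' D agree; apply: MM.2 => //.
- by split=> //; rewrite D; case: xy.
- by move=> v /set_mem/agree[].
- by move=> v /set_mem/agree[].
Qed.

Lemma cocycle_refl x : X x -> M x x = 0.
Proof.
move=> Xx; have xx : Delta X x x.
  split=> //; rewrite (_ : differ _ _ = set0) //.
  by apply/seteqP; split=> v //= [].
have /eqP := MM.1 _ _ _ xx xx.
by rewrite -subr_eq0 opprD addrA subrr sub0r oppr_eq0 => /eqP.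
Qed.

(** Half of the cost of reaching p from the opposite colouring of the component
    of v, shared equally among the vertices of this component.  Halving
    compensates for p and its flip having opposite costs, so that their
    difference is the full cost.  For an infinite component [fset_set] is empty
    and the value is zero, since the inverse of zero is zero; there M is applied
    to a pair that is not asymptotic. *)
Definition swap_energy v p : R :=
  M (level (flip (component G v) p)) (level p) /
  (#|` fset_set (component G v)|.*2)%:R.

(** The cost of creating x on B from its reference configuration, plus the share
    of B in the cost of the reference configuration itself. *)
Definition energy x B : R :=
  M (level (parity x)) (paste x B) + \sum_(v <- B) swap_energy v (parity x).

(** The pattern is extended to an arbitrary configuration of the space;
    [mobius_interactionE] says that the choice does not matter. *)
Definition mobius_interaction (a : {fmap T -> 'I_4}) : R :=
  mobius (energy (xget (fun=> ord0) [set x | X x /\ a = restr x (domf a)]))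
    (domf a).

Lemma Delta_flip S p : finite_set S -> adj_closed G S -> alternating G p ->
  Delta X (level p) (level (flip S p)).
Proof.
move=> Sfin Scl palt; split; rewrite ?differ_flip //; apply: Hom_level => //.
exact: alternating_flip.
Qed.

Lemma Delta_sym x y : Delta X x y -> Delta X y x.
Proof. by case=> Xx Xy xy; split=> //; rewrite differC. Qed.

Lemma M_anti x y : Delta X x y -> M y x = - M x y.
Proof.
move=> xy; have [Xx _ _] := xy.
apply/eqP; rewrite -addr_eq0 addrC -MM.1 ?cocycle_refl //; exact: Delta_sym.
Qed.

(** A closed set has no boundary, so the Markov property sees the colouring on
    the flipped set only. *)
Lemma flip_agree S p q : finite_set S -> adj_closed G S ->
  alternating G p -> alternating G q -> {in S, p =1 q} ->
  M (level p) (level (flip S p)) = M (level q) (level (flip S q)).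
Proof.
move=> Sfin Scl palt qalt pq; apply: markov_eq.
- exact: Delta_flip.
- exact: Hom_level.
- by apply/Hom_level/alternating_flip.
- by rewrite !differ_flip.
rewrite differ_flip boundary_closed // setU0 => v Sv.
by rewrite /level /flip pq ?inE.
Qed.

Lemma fset_set_infinite S : ~ finite_set S -> fset_set S = fset0.
Proof. by move=> Sinf; rewrite /fset_set; case: pselect. Qed.

Lemma swap_energy_infinite v p : ~ finite_set (component G v) ->
  swap_energy v p = 0.
Proof.
by move=> Kinf; rewrite /swap_energy fset_set_infinite // cardfs0 invr0 mulr0.
Qed.

(** This is what makes the swap energy a single-site interaction: the parity at
    v determines the colouring of the whole component. *)
Lemma swap_energy_local v p q : alternating G p -> alternating G q ->
  p v = q v -> swap_energy v p = swap_energy v q.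
Proof.
move=> palt qalt pqv; have [Kfin|Kinf] := pselect (finite_set (component G v)).
  have Kcl : adj_closed G (component G v) by exact: component_closed.
  rewrite /swap_energy !(@M_anti (level _) (level (flip _ _)));
    try exact: Delta_flip.
  by rewrite (flip_agree Kfin Kcl palt qalt) //; exact: alternating_agree.
by rewrite !swap_energy_infinite.
Qed.

Lemma flipK S p : flip S (flip S p) = p.
Proof. by apply/funext => v; rewrite /flip addbK. Qed.

Lemma swap_energy_flip v p q : alternating G p -> alternating G q ->
  finite_set (component G v) -> p v != q v ->
  swap_energy v q - swap_energy v p =
  M (level p) (level (flip (component G v) p)) /
  #|` fset_set (component G v)|%:R.
Proof.
move=> palt qalt Kfin pqv; set K := component G v.
have Kcl : adj_closed G K by exact: component_closed.
have qp : q v = flip K p v.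
  have vK : v \in K by rewrite inE; exact: component_refl.
  by rewrite /flip vK; move: pqv; case: (p v); case: (q v).
rewrite (swap_energy_local _ _ qp) //; last exact: alternating_flip.
rewrite /swap_energy -/K flipK (M_anti (Delta_flip Kfin Kcl palt)).
rewrite mulNr opprK -mulrDl -mulr2n -[_ *+ 2]mulr_natr -muln2 natrM invfM.
by rewrite mulrACA divff ?mulr1 // pnatr_eq0.
Qed.

(** The components in P are flipped one after the other; by [flip_agree] the
    cost of flipping the others is unaffected by the first flip.  The sum over
    the vertices of one component recovers its full cost. *)
Lemma sum_swaps (P : {fset T}) p : adj_closed G [set` P] -> alternating G p ->
  \sum_(v <- P) M (level p) (level (flip (component G v) p)) /
    #|` fset_set (component G v)|%:R =
  M (level p) (level (flip [set` P] p)).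
Proof.
move=> Pcl palt; elim/finSet_rect: P Pcl => P IH Pcl.
have [->|[v0 v0P]] := fset_0Vmem P.
  rewrite big_seq_fset0 -[RHS](_ : M (level p) (level p) = _).
    by rewrite cocycle_refl //; exact: Hom_level.
  congr (M _ (level _)); apply/funext => v.
  by rewrite /flip (_ : v \in _ = false) ?addbF //; apply/negP; rewrite inE.
pose K := fset_set (component G v0).
have KP : component G v0 `<=` [set` P] by apply: component_sub.
have Kfin : finite_set (component G v0) by exact: sub_finite_set KP _.
have KE : [set` K] = component G v0 by rewrite fset_setK.
have Kcl : adj_closed G [set` K] by rewrite KE; exact: component_closed.
have memK v : (v \in K) = (v \in component G v0) by rewrite in_fset_set.
have P'cl : adj_closed G [set` (P `\` K)%fset].
  move=> u w uw; rewrite /= !inE => /andP[uK uP]; rewrite (Pcl u w uw uP) andbT.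
  by apply/negP; apply: (adj_closedC Kcl uw); apply/negP.
have KsP : (K `<=` P)%fset by apply/fsubsetP => v; rewrite memK inE => /KP.
have P'P : (P `\` K `<` P)%fset.
  rewrite /fproper fsubsetDl; apply/fsubsetPn; exists v0 => //.
  by rewrite inE negb_and negbK memK mem_set //; exact: component_refl.
rewrite (big_fsetID _ (mem K)) /=.
have -> : [fset x | x in P & x \in K]%fset = K.
  apply/fsetP => v; rewrite !inE /= andbC.
  by case: (boolP (v \in K)) => // /(fsubsetP KsP).
have -> : [fset x | x in P & x \notin K]%fset = (P `\` K)%fset.
  by apply/fsetP => v; rewrite !inE /= andbC.
rewrite (IH _ P'P P'cl).
rewrite (eq_fbigr _
  (G := fun=> M (level p) (level (flip [set` K] p)) / #|` K|%:R)); last first.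
  move=> v vK _; have /component_eq -> : component G v0 v.
    by apply/set_mem; rewrite -memK.
  by rewrite KE.
rewrite big_const_seq count_predT iter_addr_0 -[_ *+ _]mulr_natr -mulrA.
rewrite mulVf ?mulr1; last first.
  rewrite pnatr_eq0 cardfs_eq0; apply/eqP => K0.
  have : v0 \in K by rewrite memK; apply/mem_set; exact: component_refl.
  by rewrite K0.
have PK v : (v \in [set` P]) =
    (v \in [set` K]) (+) (v \in [set` (P `\` K)%fset]).
  have mE (E : {fset T}) : (v \in [set` E]) = (v \in E).
    by apply/idP/idP; rewrite inE.
  rewrite !mE !inE.
  by case: (boolP (v \in K)) => [/(fsubsetP KsP)->|] //; case: (v \in P).
have -> : flip [set` P] p = flip [set` (P `\` K)%fset] (flip [set` K] p).
  by apply/funext => v; rewrite /flip PK addbA.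
rewrite [RHS](MM.1 _ (level (flip [set` K] p))); last 2 first.
- exact: Delta_flip.
- by apply: Delta_flip => //; exact: alternating_flip.
congr (_ + _); apply: flip_agree => //; first exact: alternating_flip.
move=> v; rewrite inE /= !inE => /andP[vK _].
by rewrite /flip (_ : v \in _ = false) ?addbF //; apply/negP; rewrite inE /=;
  exact/negP.
Qed.

Lemma paste_agree x x' B v : parity x v = parity x' v ->
  (v \in B -> x v = x' v) -> paste x B v = paste x' B v.
Proof. by rewrite /paste /level => ->; case: (v \in B) => // ->. Qed.

(** The differences between the reference and [paste x B] lie in B, and on the
    boundary only the parity of x matters, which is opposite to that of a
    neighbour in F. *)
Lemma energy_local x x' F B : X x -> X x' -> {in F, x =1 x'} ->
  (B `<=` F)%fset -> energy x B = energy x' B.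
Proof.
move=> Xx Xx' xx' /fsubsetP BF; rewrite /energy.
have par v : v \in F -> parity x v = parity x' v.
  by move=> /xx' xv; rewrite /parity xv.
congr (_ + _); last first.
  apply: eq_fbigr => v /BF vF _; apply: swap_energy_local; try exact/HomP.
  exact: par.
have D y : differ (level (parity y)) (paste y B) =
    [set v | v \in B /\ level (parity y) v <> y v].
  apply/seteqP; split=> v; rewrite /differ /= /paste; last by case=> ->.
  by case: ifP.
rewrite !level_paste; apply: markov_eq; rewrite -?level_paste.
- by rewrite level_paste; exact: Delta_paste.
- exact/Hom_level/HomP.
- exact: Hom_paste.
- rewrite !D; apply/seteqP; split=> v /= [vB];
    by rewrite /level ?xx' ?par //; exact: BF.
move=> v; rewrite D => vD.
suff [pv xv] : parity x v = parity x' v /\ (v \in B -> x v = x' v).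
  by split; [rewrite /level pv|exact: paste_agree].
split; last by move=> /BF/xx'.
case: vD => [[/BF/par //]|[_ [w [/BF/par pw _] vw]]].
have /HomP/(_ v w vw) := Xx; have /HomP/(_ v w vw) := Xx'; rewrite pw.
by case: (parity x v); case: (parity x' v); case: (parity x' w).
Qed.

Lemma mobius_interactionE x F : X x ->
  mobius_interaction (restr x F) = mobius (energy x) F.
Proof.
move=> Xx; rewrite /mobius_interaction /=; set x' := xget _ _.
have [Xx' /restrP xx'] : X x' /\ restr x F = restr x' F.
  exact: (@xgetPex _ (fun=> ord0) [set y | X y /\ restr x F = restr y F]
    (ex_intro _ x (conj Xx erefl))).
apply: eq_mobius => B BF; apply: energy_local BF => // v vF.
by rewrite xx'.
Qed.

Lemma energyU1 x w B : X x -> w \notin B ->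
  energy x (w |` B)%fset - energy x B =
  M (paste x B) (paste x (w |` B)%fset) + swap_energy w (parity x).
Proof.
move=> Xx wB; rewrite /energy big_fsetU1 //= level_paste.
rewrite (MM.1 _ (paste x B) (paste x (w |` B)%fset)); try exact: Delta_paste.
by rewrite opprD addrACA addrK [M _ _ + M _ _]addrC addrK.
Qed.

(** By [energyU1] the first difference of the energy in the direction of w is
    the cost of a change at w alone, up to a term depending on w only.  By the
    Markov property this cost ignores the symbol at u, since u is neither w nor
    a neighbour of w, so the second difference is zero. *)
Lemma mobius_interaction_nn : nn_interaction G X mobius_interaction.
Proof.
move=> _ [x [F [Xx ->]]] /= Fncl; rewrite mobius_interactionE //.
have [u [w [uF wF uw nuw]]] :
    exists u w, [/\ u \in F, w \in F, u != w & ~ G u w].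
  apply: contrapT => nex; apply: Fncl => u w uF wF uw.
  by apply: contrapT => nuw; apply: nex; exists u, w.
apply: (mobius0 uw uF wF) => B BF uB wB.
rewrite fsetUCA !energyU1 //; last by rewrite !inE negb_or eq_sym uw.
congr (_ + _).
have pu C v : v != u -> paste x (u |` C)%fset v = paste x C v.
  by move=> vu; rewrite /paste !inE (negPf vu).
have pw C v : v != w -> paste x (w |` C)%fset v = paste x C v.
  by move=> vw; rewrite /paste !inE (negPf vw).
have dw C v : differ (paste x C) (paste x (w |` C)%fset) v -> v = w.
  by move=> Cv; apply/eqP/negPn/negP => /(pw C) pv; apply: Cv; rewrite pv.
apply: markov_eq; [exact: Delta_paste|exact: Hom_paste|exact: Hom_paste| |].
- apply/seteqP; split=> v /[dup] /dw -> wD.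
    by rewrite /differ /= fsetUCA !pu // eq_sym.
  by move: wD; rewrite /differ /= fsetUCA !pu // eq_sym.
move=> v vD; have vu : v != u.
  case: vD => [/dw ->|[_ [b /dw -> vw]]]; first by rewrite eq_sym.
  by apply/eqP => vu; apply: nuw; rewrite -vu.
by rewrite [(w |` _)%fset]fsetUCA !pu.
Qed.

(** Vertices of equal parity contribute zero; the others form a finite closed
    set, on which the swap energies add up to the cost of the flip. *)
Lemma sum_swap_energy x y (E : {fset T}) : X x -> X y ->
  [set v | parity x v != parity y v] `<=` [set` E] ->
  \sum_(v <- E) (swap_energy v (parity y) - swap_energy v (parity x)) =
  M (level (parity x)) (level (parity y)).
Proof.
move=> /HomP Xx /HomP Xy sub.
rewrite (big_fsetID _ (fun v => parity x v != parity y v)) /=.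
rewrite [X in _ + X]big1_fset ?addr0; last first.
  move=> v; rewrite !inE /= => /andP[_ /negPn/eqP xy] _.
  by rewrite (swap_energy_local Xx Xy xy) subrr.
set P := [fset v in E | parity x v != parity y v]%fset.
have PE : [set` P] = [set v | parity x v != parity y v].
  apply/seteqP; split=> v /=; rewrite !inE /=; first by case/andP.
  by move=> xy; rewrite xy andbT; exact: sub.
have Pcl : adj_closed G [set` P] by rewrite PE; exact: differ_closed.
have -> : parity y = flip [set` P] (parity x).
  apply/funext => v; rewrite /flip PE.
  rewrite (_ : (v \in _) = (parity x v != parity y v)).
    by case: (parity x v); case: (parity y v).
  by apply/idP/idP; rewrite inE.
rewrite -sum_swaps //; apply: eq_fbigr => v vP _.
have [vPs xyv] : [set` P] v /\ parity x v != parity y v.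
  by split=> //; move: vP; rewrite !inE /= => /andP[].
rewrite swap_energy_flip //; first exact: alternating_flip.
  exact: sub_finite_set (component_sub Pcl vPs) _.
by rewrite eq_sym flipE inE.
Qed.

(** With E the set of differences and its boundary, [mobius_sum] turns the Gibbs
    sum into a difference of energies on E.  By the Markov property M does not
    change when x and y are reduced outside E; the path from [paste x E] to
    [paste y E] through the two references then gives the same value. *)
Lemma mobius_interaction_gibbs x y : Delta X x y ->
  M x y = gibbs_sum mobius_interaction x y.
Proof.
move=> xy; have [Xx Xy fxy] := xy.
have [E EE] : exists E : {fset T},
    differ x y `|` boundary G (differ x y) = [set` E].
  apply/finite_fsetP; rewrite finite_setU.
  by split=> //; exact: finite_boundary.
rewrite (gibbs_sumE (E := E) mobius_interaction_nn) ?EE //.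
under eq_bigr do rewrite !mobius_interactionE //.
rewrite sumrB !mobius_sum /energy.
have sub : [set v | parity x v != parity y v] `<=` [set` E].
  move=> v pv; rewrite -EE; left => xyv; move/eqP: pv; apply.
  by rewrite /parity xyv.
have := sum_swap_energy Xx Xy sub; rewrite sumrB => swaps.
have -> : M x y = M (paste x E) (paste y E).
  apply: markov_eq; [by []|exact: Hom_paste|exact: Hom_paste| |].
    apply/seteqP; split=> v; rewrite /differ /= /paste; last first.
      move=> xyv vE; have vD : differ x y v by [].
      have : [set` E] v by rewrite -EE; left.
      by move=> /= vE'; move: vE; rewrite vE'.
    case: ifP => // vE; rewrite /level => pxy _.
    apply: pxy; congr (inord (nat_of_bool _)); apply/eqP/negPn/negP => /sub /=.
    by rewrite vE.
  by rewrite EE => v /= vE; rewrite /paste vE.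
have lx : Delta X (level (parity x)) (paste x E).
  by rewrite level_paste; exact: Delta_paste.
have ly : Delta X (level (parity y)) (paste y E).
  by rewrite level_paste; exact: Delta_paste.
have lxy : Delta X (level (parity x)) (level (parity y)).
  split; [exact/Hom_level/HomP|exact/Hom_level/HomP|].
  by rewrite differ_level; exact: sub_finite_set sub _.
have lxp : Delta X (level (parity x)) (paste y E).
  split; [exact/Hom_level/HomP|exact: Hom_paste|].
  have [[_ _ f1] [_ _ f2]] := (lxy, ly).
  apply: (@sub_finite_set _ _ (differ (level (parity x)) (level (parity y)) `|`
    differ (level (parity y)) (paste y E))); last by rewrite finite_setU.
  move=> v dv; apply: contrapT => /not_orP[/contrapT + /contrapT].
  by move=> e1 e2; apply: dv; rewrite e1.
rewrite (MM.1 _ _ _ (Delta_sym lx) lxp) (M_anti lx) (MM.1 _ _ _ lxy ly) -swaps.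
by rewrite opprD [RHS]addrACA [LHS]addrC -[LHS]addrA [LHS]addrC.
Qed.

Lemma act_paste (g : aut G) x B :
  paste (act g x) (g @` B)%fset = act g (paste x B).
Proof.
apply/funext => v; rewrite /act /paste /level /parity.
suff -> : (v \in (g @` B)%fset) = ((g^-1)%g v \in B) by [].
apply/imfsetP/idP => [[w /= wB ->]|vB].
  by rewrite aut_funK.
by exists ((g^-1)%g v) => //=; rewrite aut_mulVK.
Qed.

Lemma Hom_act (g : aut G) x : X x -> X (act g x).
Proof. by move=> Xx u w uw; apply: Xx; rewrite aut_adj. Qed.

Lemma swap_energy_act (Gr : {pred aut G}) (g : aut G) v x :
  invariant_cocycle Gr X M -> g \in Gr -> X x ->
  swap_energy (g v) (parity (act g x)) = swap_energy v (parity x).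
Proof.
move=> Minv gGr /HomP Xx.
have [Kfin|Kinf] := pselect (finite_set (component G v)); last first.
  rewrite !swap_energy_infinite // => gKfin; apply: Kinf.
  have -> : component G v = (g^-1)%g @` component G (g v).
    by rewrite -component_aut aut_mulKV.
  exact: finite_image.
have flip_act : level (flip (component G (g v)) (parity (act g x))) =
    act g (level (flip (component G v) (parity x))).
  apply/funext => w; rewrite /level /flip /act /parity component_aut.
  suff -> : (w \in g @` component G v) = ((g^-1)%g w \in component G v) by [].
  apply/idP/idP => /set_mem => [[u vu <-]|vw]; apply/mem_set.
    by rewrite aut_mulKV.
  by exists ((g^-1)%g w) => //; rewrite aut_mulVK.
rewrite /swap_energy flip_act.
rewrite (_ : level (parity _) = act g (level (parity x))) //.
rewrite Minv //; last first.
  by apply/Delta_sym/Delta_flip => //; exact: component_closed.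
rewrite component_aut fset_set_image // card_imfset //.
exact: can_inj (aut_funK g).
Qed.

(** Reduction, pasting, components and hence the energy commute with
    automorphisms. *)
Lemma mobius_interaction_inv (Gr : {pred aut G}) : group_closed Gr ->
  invariant_cocycle Gr X M -> invariant_interaction Gr X mobius_interaction.
Proof.
move=> GrG Minv g' gGr' _ [x [F [Xx ->]]].
have : (g'^-1)%g \in Gr by exact: group_closedV.
(* The invariance condition only involves the inverse of g', renamed g. *)
move: (g'^-1)%g => {gGr'}g gGr; have gI := can_inj (aut_funK g).
rewrite restr_act !mobius_interactionE //; last exact: Hom_act.
rewrite mobius_imfset //; apply: eq_bigr => B _; congr (_ * _).
rewrite /energy big_imfset /=; last by move=> u w _ _ /gI.
congr (_ + _); last first.
  by apply: eq_bigr => v _; exact: swap_energy_act Minv gGr Xx.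
rewrite act_paste.
have -> : level (parity (act g x)) = act g (level (parity x)) by [].
by rewrite Minv // level_paste; exact: Delta_paste.
Qed.

End MarkovCocycle.

Lemma Hom_invariant (Gr : {pred aut G}) : invariant_space Gr X.
Proof.
move=> g _; apply/seteqP; split=> [_ [x Xx <-]|x Xx]; first exact: Hom_act.
exists (act (g^-1)%g x); first exact: Hom_act.
apply/funext => v; rewrite /act invgK.
by rewrite aut_mulVK.
Qed.

End HomC4.

Theorem mainTheorem5 (R : realType) (T : countType) (G : graph T)
    (Gr : {pred aut G}) :
  bipartite G -> group_closed Gr ->
  hammersley_clifford R G (Hom_space G C4) /\
  Gr_hammersley_clifford R Gr (Hom_space G C4).
Proof.
move=> _ GrG; split.
  apply/seteqP; split=> [M MM|]; last exact: gibbs_cocycle_markov.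
  exists (mobius_interaction G M); first exact: mobius_interaction_nn.
  exact: mobius_interaction_gibbs.
split; first exact: Hom_invariant.
apply/seteqP; split=> [M [MM Minv]|M [V [nnV Vinv] MV]].
  exists (mobius_interaction G M); last exact: mobius_interaction_gibbs.
  by split; [exact: mobius_interaction_nn|exact: mobius_interaction_inv].
split; first by apply: gibbs_cocycle_markov; exists V.
move=> g gGr x y xy; have [Xx Xy fxy] := xy.
have gxy : Delta (Hom_space G C4) (act g x) (act g y).
  split; [exact: Hom_act|exact: Hom_act|].
  apply: (@sub_finite_set _ _ (g @` differ x y)); last exact: finite_image.
  move=> v dv; exists ((g^-1)%g v) => //.
  by rewrite aut_mulVK.
by rewrite !MV // (gibbs_sum_inv GrG Vinv).
Qed.
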